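(* Let $a,b>0$ and $0\leq v\leq 1$. Then $$(1-v)a+vb\ \geq\ a^{1-v}b^{v}+r_{0}(v)(\sqrt{a}-\sqrt{b})^{2}+\alpha(v)\zeta(a,b)\qquad (i)$$ and $$(1-v)a+vb\ \leq\ a+b-a^{v}b^{1-v}-r_{0}(v)(\sqrt{a}-\sqrt{b})^{2}-\alpha(v)\zeta(a,b)\ \leq\ a^{1-v}b^{v}+R_{0}(v)(\sqrt{a}-\sqrt{b})^{2}-\alpha(v)\zeta(a,b).\qquad (ii)$$ Moreover, if $a,b\geq 1$, then (i) and the first inequality in (ii) are stronger than, respectively, the lower and upper bounds $$a^{1-v}b^{v}+r_{0}(v)(\sqrt{a}-\sqrt{b})^{2}+\alpha(v)\left(\ln\tfrac{b}{a}\right)^{2}\leq(1-v)a+vb\leq a^{1-v}b^{v}+R_{0}(v)(\sqrt{a}-\sqrt{b})^{2}+\alpha(v)\left(\ln\tfrac{b}{a}\right)^{2};$$ that is, for $a,b\ge 1$ and $0\le v\le 1$, $$a^{1-v}b^{v}+r_{0}(v)(\sqrt{a}-\sqrt{b})^{2}+\alpha(v)\zeta(a,b)\ \geq\ a^{1-v}b^{v}+r_{0}(v)(\sqrt{a}-\sqrt{b})^{2}+\alpha(v)\left(\ln\tfrac{b}{a}\right)^{2}$$ and $$a+b-a^{v}b^{1-v}-r_{0}(v)(\sqrt{a}-\sqrt{b})^{2}-\alpha(v)\zeta(a,b)\ \leq\ a^{1-v}b^{v}+R_{0}(v)(\sqrt{a}-\sqrt{b})^{2}+\alpha(v)\lef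t(\ln\tfrac{b}{a}\right)^{2}.$$
   Context: $r_0(v)=\min\{v,1-v\}$, $R_0(v)=1-r_0(v)$, $\alpha(v)=\frac12 v(1-v)-\frac14 r_0(v)=\frac14 r_0(v)|1-2v|$, and $\zeta(a,b)=\left(\ln\frac{b}{a}\right)^2\min\{a,b\}$. *)

(* Defs.v *)
From Stdlib Require Import Reals Lra.
Open Scope R_scope.

Definition r_0 (v : R) : R := Rmin v (1 - v).

Definition R_0 (v : R) : R := 1 - r_0 v.

Definition alpha (v : R) : R := / 2 * v * (1 - v) - / 4 * r_0 v.

Lemma alpha_abs (v : R) : alpha v = / 4 * r_0 v * Rabs (1 - 2 * v).
Proof.
unfold alpha, r_0, Rmin, Rabs.
destruct (Rle_dec v (1 - v)); destruct (Rcase_abs (1 - 2 * v)); lra || nra.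
Qed.

Definition zeta (a b : R) : R := (ln (b / a)) ^ 2 * Rmin a b.

(* Main.v *)
Require Import Defs.
From Stdlib Require Import Reals.
From Stdlib Require Import Lra.
Open Scope R_scope.

(** The exponential is strongly convex: for [t >= ln m] its second derivative
    is at least [m], so [exp t - m * t ^ 2 / 2] is convex there.  At the points
    [ln a] and [ln c], with [m <= min (a, c)], this is the weighted
    arithmetic-geometric mean inequality with a logarithmic remainder
    ([strong_young]):
      [a^(1-w) c^w + w (1 - w) / 2 * m * (ln a - ln c)^2 <= (1 - w) a + w c].

    For [v <= 1/2] the square [v (sqrt a - sqrt b)^2] is exactly what turns the
    weighted mean of [a] and [b] into a weighted mean of [a] and [sqrt (a b)]:
      [(1 - v) a + v b - v (sqrt a - sqrt b)^2 = (1 - 2v) a + 2v sqrt (a b)].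
    The corresponding geometric means agree, the logarithmic gap is halved, and
    [min (a, b) <= min (a, sqrt (a b))]; so [strong_young] with [c = sqrt (a b)]
    and [w = 2v] gives [refined_young_half], with the constant
    [2v (1 - 2v) / 8 = alpha v].  The range [v >= 1/2] follows from the symmetry [(a, b, v) -> (b, a, 1 - v)].

    Exchanging [a] and [b] in [refined_young] and subtracting from [a + b] gives
    the reverse bound.  Its comparison with the bound that has [R_0 v] as
    coefficient reduces to the Heinz inequality
      [2 sqrt (a b) <= a^(1-v) b^v + a^v b^(1-v)],
    because [r_0 v + R_0 v = 1].  When [a, b >= 1], the comparisons follow from
    [zeta a b >= (ln (b / a))^2] and [alpha v >= 0]. *)

(** * Strong convexity of the exponential *)

Lemma nonneg_derivative_le (f f' : R -> R) (p q : R) :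
  p <= q ->
  (forall t, p <= t <= q -> derivable_pt_lim f t (f' t)) ->
  (forall t, p <= t <= q -> 0 <= f' t) ->
  f p <= f q.
Proof.
intros [Hpq | <-] Hd Hpos; [|lra].
destruct (MVT_cor2 f f' p q Hpq Hd) as [c [Hc Hin]].
assert (0 <= f' c) by (apply Hpos; lra).
nra.
Qed.

Lemma exp_ge_quadratic (t : R) : 0 <= t -> 1 + t + t ^ 2 / 2 <= exp t.
Proof.
intros Ht.
assert (H : exp 0 - 1 - 0 - 0 * 0 * / 2 <= exp t - 1 - t - t * t * / 2).
{ apply (nonneg_derivative_le (fun u => exp u - 1 - u - u * u * / 2)
           (fun u => exp u - 1 - u)); [lra | |].
  - intros u _.
    replace (exp u - 1 - u)
      with (exp u - 0 - 1 - ((1 * u + u * 1) * / 2 + u * u * 0)) by field.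
    apply (derivable_pt_lim_minus (fun u => exp u - 1 - u) (fun u => u * u * / 2)).
    + apply (derivable_pt_lim_minus (fun u => exp u - 1) (fun u => u)).
      * apply (derivable_pt_lim_minus exp (fun _ => 1)).
        -- apply derivable_pt_lim_exp.
        -- apply derivable_pt_lim_const.
      * apply derivable_pt_lim_id.
    + apply (derivable_pt_lim_mult (fun u => u * u) (fun _ => / 2)).
      * apply (derivable_pt_lim_mult (fun u => u) (fun u => u));
          apply derivable_pt_lim_id.
      * apply derivable_pt_lim_const.
  - intros u _. pose proof (exp_ineq1_le u). lra. }
rewrite exp_0 in H. nra.
Qed.

(** On the negative side the second derivative of [exp] between [t] and [0] is
    only bounded below by [exp t].  Multiplying by [exp s], where [t = - s],
    leaves [(1 - s) exp s <= 1 - s ^ 2 / 2], whose two sides agree at [0] and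
    whose derivatives differ by [s (exp s - 1) >= 0]. *)
Lemma exp_neg_aux (s : R) : 0 <= s -> (1 - s) * exp s <= 1 - s ^ 2 / 2.
Proof.
intros Hs.
assert (H : (0 - 1) * exp 0 - 0 * 0 * / 2 <= (s - 1) * exp s - s * s * / 2).
{ apply (nonneg_derivative_le (fun u => (u - 1) * exp u - u * u * / 2)
           (fun u => u * (exp u - 1))); [lra | |].
  - intros u _.
    replace (u * (exp u - 1))
      with ((1 - 0) * exp u + (u - 1) * exp u
            - ((1 * u + u * 1) * / 2 + u * u * 0)) by field.
    apply (derivable_pt_lim_minus (fun u => (u - 1) * exp u)
                                  (fun u => u * u * / 2)).
    + apply (derivable_pt_lim_mult (fun u => u - 1) exp).
      * apply (derivable_pt_lim_minus (fun u => u) (fun _ => 1)).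
        -- apply derivable_pt_lim_id.
        -- apply derivable_pt_lim_const.
      * apply derivable_pt_lim_exp.
    + apply (derivable_pt_lim_mult (fun u => u * u) (fun _ => / 2)).
      * apply (derivable_pt_lim_mult (fun u => u) (fun u => u));
          apply derivable_pt_lim_id.
      * apply derivable_pt_lim_const.
  - intros u Hu. pose proof (exp_ineq1_le u). nra. }
rewrite exp_0 in H. nra.
Qed.

Lemma exp_ge_tangent_quadratic (t m : R) :
  m <= 1 -> m <= exp t -> 1 + t + m * t ^ 2 / 2 <= exp t.
Proof.
intros H1 Ht.
pose proof (pow2_ge_0 t) as Ht2.
destruct (Rle_lt_dec 0 t) as [Hpos | Hneg].
- pose proof (exp_ge_quadratic t Hpos). nra.
- pose proof (exp_neg_aux (- t) ltac:(lra)) as H.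
  pose proof (exp_pos t) as He.
  assert (Hinv : exp t * exp (- t) = 1)
    by (rewrite <- exp_plus, Rplus_opp_r; apply exp_0).
  assert (H' : exp t * ((1 - - t) * exp (- t)) <= exp t * (1 - (- t) ^ 2 / 2))
    by (apply Rmult_le_compat_l; lra).
  replace (exp t * ((1 - - t) * exp (- t)))
    with ((1 + t) * (exp t * exp (- t))) in H' by ring.
  rewrite Hinv in H'. nra.
Qed.

(** The previous bound, rescaled to a tangent at an arbitrary point [z]. *)
Lemma exp_ge_tangent_quadratic_at (x z m : R) :
  m <= exp x -> m <= exp z ->
  exp z + exp z * (x - z) + m * (x - z) ^ 2 / 2 <= exp x.
Proof.
intros Hx Hz.
pose proof (exp_pos z) as He.
assert (Ex : exp x = exp z * exp (x - z))
  by (rewrite <- exp_plus; f_equal; ring).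
assert (Em : m = exp z * (m / exp z)) by (field; lra).
rewrite Ex in Hx |- *. rewrite Em in Hx, Hz |- *.
set (k := m / exp z) in *.
assert (Hk1 : k <= 1) by (apply (Rmult_le_reg_l (exp z)); lra).
assert (Hk2 : k <= exp (x - z)) by (apply (Rmult_le_reg_l (exp z)); lra).
pose proof (exp_ge_tangent_quadratic _ _ Hk1 Hk2) as H.
apply (Rmult_le_compat_l (exp z)) in H; [|lra].
lra.
Qed.

(** Average the two quadratic tangent bounds at [z = (1 - w) x + w y]: the
    linear terms cancel and the squares add up to [w (1 - w) (x - y) ^ 2]. *)
Lemma exp_strongly_convex (x y w m : R) :
  0 <= w <= 1 -> m <= exp x -> m <= exp y ->
  exp ((1 - w) * x + w * y) + w * (1 - w) / 2 * m * (x - y) ^ 2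
    <= (1 - w) * exp x + w * exp y.
Proof.
intros Hw Hx Hy.
set (z := (1 - w) * x + w * y).
assert (Hz : m <= exp z).
{ (* [z] lies between [x] and [y] and [exp] is increasing *)
  destruct (Rle_lt_dec x y) as [Hxy | Hxy].
  - assert (Hle : x <= z) by (unfold z; nra).
    destruct Hle as [Hlt | <-]; [pose proof (exp_increasing _ _ Hlt) |]; lra.
  - assert (Hle : y <= z) by (unfold z; nra).
    destruct Hle as [Hlt | <-]; [pose proof (exp_increasing _ _ Hlt) |]; lra. }
pose proof (exp_ge_tangent_quadratic_at x z m Hx Hz) as Tx.
pose proof (exp_ge_tangent_quadratic_at y z m Hy Hz) as Ty.
apply (Rmult_le_compat_l (1 - w)) in Tx; [|lra].
apply (Rmult_le_compat_l w) in Ty; [|lra].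
apply Rle_trans with (2 := Rplus_le_compat _ _ _ _ Tx Ty).
generalize (exp z); intros e; unfold z.
apply Req_le. field.
Qed.

(** * Refined Young inequalities *)

Lemma Rpower_mult_exp (a b p q : R) :
  Rpower a p * Rpower b q = exp (p * ln a + q * ln b).
Proof. unfold Rpower. now rewrite <- exp_plus. Qed.

Lemma strong_young (a c w m : R) :
  0 < a -> 0 < c -> 0 <= w <= 1 -> m <= a -> m <= c ->
  Rpower a (1 - w) * Rpower c w + w * (1 - w) / 2 * m * (ln a - ln c) ^ 2
    <= (1 - w) * a + w * c.
Proof.
intros Ha Hc Hw Hma Hmc.
rewrite Rpower_mult_exp.
rewrite <- (exp_ln a Ha) in Hma. rewrite <- (exp_ln c Hc) in Hmc.
pose proof (exp_strongly_convex (ln a) (ln c) w m Hw Hma Hmc) as H.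
now rewrite (exp_ln a Ha), (exp_ln c Hc) in H.
Qed.

Lemma ln_sqrt (x : R) : 0 < x -> ln (sqrt x) = ln x / 2.
Proof.
intros Hx.
pose proof (sqrt_lt_R0 x Hx) as Hs.
assert (H : ln x = ln (sqrt x) + ln (sqrt x))
  by (rewrite <- ln_mult, sqrt_sqrt; lra).
lra.
Qed.

Lemma sqrt_diff_sqr (a b : R) :
  0 < a -> 0 < b -> (sqrt a - sqrt b) ^ 2 = a + b - 2 * sqrt (a * b).
Proof.
intros Ha Hb.
rewrite sqrt_mult by lra.
pose proof (sqrt_sqrt a ltac:(lra)). pose proof (sqrt_sqrt b ltac:(lra)).
nra.
Qed.

Lemma Rmin_le_sqrt_mult (a b : R) :
  0 < a -> 0 < b -> Rmin a b <= sqrt (a * b).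
Proof.
intros Ha Hb.
pose proof (Rmin_l a b). pose proof (Rmin_r a b).
pose proof (Rmin_glb_lt a b 0 Ha Hb).
rewrite <- (sqrt_Rsqr (Rmin a b)) by lra.
apply sqrt_le_1_alt. unfold Rsqr. nra.
Qed.

Lemma zeta_ln (a b : R) :
  0 < a -> 0 < b -> zeta a b = (ln a - ln b) ^ 2 * Rmin a b.
Proof.
intros Ha Hb. unfold zeta, Rdiv.
rewrite ln_mult, ln_Rinv by (try apply Rinv_0_lt_compat; lra).
ring.
Qed.

Lemma zeta_sym (a b : R) : 0 < a -> 0 < b -> zeta a b = zeta b a.
Proof. intros Ha Hb. rewrite !zeta_ln, Rmin_comm by lra. ring. Qed.

Lemma r_0_sym (v : R) : r_0 (1 - v) = r_0 v.
Proof. unfold r_0. rewrite Rmin_comm. f_equal; ring. Qed.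

Lemma alpha_sym (v : R) : alpha (1 - v) = alpha v.
Proof. unfold alpha. rewrite r_0_sym. ring. Qed.

Lemma r_0_half (v : R) : v <= 1 / 2 -> r_0 v = v.
Proof. intros Hv. unfold r_0. apply Rmin_left. lra. Qed.

Lemma alpha_nonneg (v : R) : 0 <= v <= 1 -> 0 <= alpha v.
Proof.
intros Hv. rewrite alpha_abs.
pose proof (Rabs_pos (1 - 2 * v)).
assert (0 <= r_0 v) by (apply Rmin_glb; lra).
apply Rmult_le_pos; lra.
Qed.

(** This is [strong_young] for [a] and [sqrt (a * b)] with weight [2 * v]. *)
Lemma refined_young_half (a b v : R) :
  0 < a -> 0 < b -> 0 <= v <= 1 / 2 ->
  Rpower a (1 - v) * Rpower b v + r_0 v * (sqrt a - sqrt b) ^ 2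
    + alpha v * zeta a b <= (1 - v) * a + v * b.
Proof.
intros Ha Hb Hv.
assert (Hab : 0 < a * b) by nra.
pose proof (strong_young a (sqrt (a * b)) (2 * v) (Rmin a b) Ha
  (sqrt_lt_R0 _ Hab) ltac:(lra) (Rmin_l a b) (Rmin_le_sqrt_mult a b Ha Hb)) as H.
rewrite Rpower_mult_exp, ln_sqrt, ln_mult in H by lra.
rewrite Rpower_mult_exp, zeta_ln, sqrt_diff_sqr by lra.
unfold alpha. rewrite r_0_half by lra.
(* the two geometric means coincide *)
replace ((1 - 2 * v) * ln a + 2 * v * ((ln a + ln b) / 2))
  with ((1 - v) * ln a + v * ln b) in H by field.
lra.
Qed.

Lemma refined_young (a b v : R) :
  0 < a -> 0 < b -> 0 <= v <= 1 ->
  Rpower a (1 - v) * Rpower b v + r_0 v * (sqrt a - sqrt b) ^ 2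
    + alpha v * zeta a b <= (1 - v) * a + v * b.
Proof.
intros Ha Hb Hv.
destruct (Rle_lt_dec v (1 / 2)) as [H | H].
- apply refined_young_half; lra.
- pose proof (refined_young_half b a (1 - v) Hb Ha ltac:(lra)) as H'.
  rewrite r_0_sym, alpha_sym, (zeta_sym b a Hb Ha) in H'.
  replace (1 - (1 - v)) with v in H' by ring.
  lra.
Qed.

(** The two summands on the right have product [a * b], so this is the
    arithmetic-geometric mean inequality for them. *)
Lemma heinz (a b v : R) :
  0 < a -> 0 < b ->
  2 * sqrt (a * b) <=
    Rpower a (1 - v) * Rpower b v + Rpower a v * Rpower b (1 - v).
Proof.
intros Ha Hb.
set (p := Rpower a (1 - v) * Rpower b v).
set (q := Rpower a v * Rpower b (1 - v)).
assert (Hp : 0 < p) by (unfold p; rewrite Rpower_mult_exp; apply exp_pos).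
assert (Hq : 0 < q) by (unfold q; rewrite Rpower_mult_exp; apply exp_pos).
assert (Hpq : p * q = a * b).
{ unfold p, q. rewrite !Rpower_mult_exp, <- exp_plus.
  replace ((1 - v) * ln a + v * ln b + (v * ln a + (1 - v) * ln b))
    with (ln a + ln b) by ring.
  now rewrite exp_plus, !exp_ln. }
pose proof (sqrt_diff_sqr p q Hp Hq) as H.
rewrite Hpq in H.
pose proof (pow2_ge_0 (sqrt p - sqrt q)). lra.
Qed.

Theorem corollary8 :
  forall a b v : R, 0 < a -> 0 < b -> 0 <= v <= 1 ->
  (1 - v) * a + v * b >=
    Rpower a (1 - v) * Rpower b v + r_0 v * (sqrt a - sqrt b) ^ 2
    + alpha v * zeta a b
  /\
  (1 - v) * a + v * b <=
    a + b - Rpower a v * Rpower b (1 - v) - r_0 v * (sqrt a - sqrt b) ^ 2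
    - alpha v * zeta a b
  /\
  a + b - Rpower a v * Rpower b (1 - v) - r_0 v * (sqrt a - sqrt b) ^ 2
    - alpha v * zeta a b <=
    Rpower a (1 - v) * Rpower b v + R_0 v * (sqrt a - sqrt b) ^ 2
    - alpha v * zeta a b
  /\
  (1 <= a -> 1 <= b ->
    Rpower a (1 - v) * Rpower b v + r_0 v * (sqrt a - sqrt b) ^ 2
      + alpha v * (ln (b / a)) ^ 2 <= (1 - v) * a + v * b
    /\
    (1 - v) * a + v * b <=
      Rpower a (1 - v) * Rpower b v + R_0 v * (sqrt a - sqrt b) ^ 2
      + alpha v * (ln (b / a)) ^ 2
    /\
    Rpower a (1 - v) * Rpower b v + r_0 v * (sqrt a - sqrt b) ^ 2
      + alpha v * zeta a b >=
      Rpower a (1 - v) * Rpower b v + r_0 v * (sqrt a - sqrt b) ^ 2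
      + alpha v * (ln (b / a)) ^ 2
    /\
    a + b - Rpower a v * Rpower b (1 - v) - r_0 v * (sqrt a - sqrt b) ^ 2
      - alpha v * zeta a b <=
      Rpower a (1 - v) * Rpower b v + R_0 v * (sqrt a - sqrt b) ^ 2
      + alpha v * (ln (b / a)) ^ 2).
Proof.
intros a b v Ha Hb Hv.
pose proof (refined_young a b v Ha Hb Hv) as Lo.
(* exchanging [a] and [b] bounds [v a + (1 - v) b] from below *)
pose proof (refined_young b a v Hb Ha Hv) as Up.
rewrite (zeta_sym b a Hb Ha) in Up.
replace ((sqrt b - sqrt a) ^ 2) with ((sqrt a - sqrt b) ^ 2) in Up by ring.
pose proof (heinz a b v Ha Hb) as Hz.
assert (Hmid : a + b - Rpower a v * Rpower b (1 - v)
    - r_0 v * (sqrt a - sqrt b) ^ 2 - alpha v * zeta a b <=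
  Rpower a (1 - v) * Rpower b v + R_0 v * (sqrt a - sqrt b) ^ 2
    - alpha v * zeta a b).
{ unfold R_0. pose proof (sqrt_diff_sqr a b Ha Hb). lra. }
pose proof (alpha_nonneg v Hv) as Hal.
split; [lra|]. split; [lra|]. split; [exact Hmid|].
intros Ha1 Hb1.
set (L := (ln (b / a)) ^ 2).
assert (HL : 0 <= L) by apply pow2_ge_0.
assert (Hzeta : L <= zeta a b).
{ unfold zeta. fold L. pose proof (Rmin_glb a b 1 Ha1 Hb1) as Hm.
  rewrite <- (Rmult_1_r L) at 1. apply Rmult_le_compat_l; lra. }
assert (HaL : 0 <= alpha v * L) by (apply Rmult_le_pos; lra).
assert (Hcmp : alpha v * L <= alpha v * zeta a b)
  by (apply Rmult_le_compat_l; lra).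
split; [lra|]. split; [lra|]. split; lra.
Qed.
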